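(* Let $b\ge2$. The polyadic ring $\mathcal{R}^{[1,b]}_{b+1,2}=\langle\{1+bk\mid k\in\mathbb{Z}\}\mid\nu_{b+1},\mu_2\rangle$, where $\nu_{b+1}[x_1,\ldots,x_{b+1}]=x_1+\cdots+x_{b+1}$ and $\mu_2[x_1,x_2]=x_1x_2$ in $\mathbb{Z}$, can be embedded into a $(b+1,2)$-ary field; that is, there exist a $(b+1,2)$-field and an injective map from $\{1+bk\mid k\in\mathbb{Z}\}$ into it which preserves the $(b+1)$-ary additions and the binary multiplications.
   Context: A polyadic $(m,n)$-ring is a set $A$ with a commutative $m$-ary group operation $\nu_m$ (totally associative, permutation-invariant, $\nu_m[\mathbf{a},x,\mathbf{b}]=c$ solvable for $x$ on any place) and a totally associative $n$-ary operation $\mu_n$ which distributes over $\nu_m$ on each of its $n$ places. An element $z$ is a zero if $\mu_n$ takes the value $z$ whenever one of its arguments (on any place) is $z$. Let $A^{*}=A\setminus\{z\}$ if a zero $z$ exists and $A^{*}=A$ otherwise. The ring is an $(m,n)$-field if $\langle A^{*}\mid\mu_n\rangle$ is a commutative $n$-ary group, i.e. $A^*$ is closed under $\mu_n$, $\mu_n$ is totally associative and permutation-invariant, and $\mu_n[\mathbf{a},x,\mathbf{b}]=c$ is solvable for $x\in A^{*}$ on any place. *)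

(* Defs.v *)
From HB Require Import structures.
From mathcomp Require Import all_boot all_order all_fingroup all_algebra.
From mathcomp Require Import ring zify.

Set Implicit Arguments.
Unset Strict Implicit.
Unset Printing Implicit Defensive.

Import GRing.Theory.
Local Open Scope ring_scope.

Section PolyadicOperations.
Variables (A : Type) (n : nat).
Implicit Types (op : {ffun 'I_n -> A} -> A) (D : A -> Prop).

Definition replace_at (x : {ffun 'I_n -> A}) (i : 'I_n) (a : A) :
  {ffun 'I_n -> A} := [ffun j => if j == i then a else x j].

(* op[w_0,..,w_{k-1}, op[w_k,..,w_{k+n-1}], w_{k+n},..,w_{2n-2}]; only the
   first 2n-1 letters of the word w are used. *)
Definition nested_op op (w : nat -> A) (k : 'I_n) : A :=
  op [ffun i : 'I_n => if (i < k)%N then w i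
                       else if i == k then op [ffun j : 'I_n => w (k + j)%N]
                       else w (i + n.-1)%N].

Definition total_assoc_on D op : Prop :=
  forall w : nat -> A, (forall i, D (w i)) ->
  forall k l : 'I_n, nested_op op w k = nested_op op w l.

Definition perm_invariant_on D op : Prop :=
  forall x : {ffun 'I_n -> A}, (forall i, D (x i)) ->
  forall s : 'S_n, op [ffun i => x (s i)] = op x.

Definition solvable_on D op : Prop :=
  forall (x : {ffun 'I_n -> A}) (i : 'I_n) (c : A),
  (forall j, j != i -> D (x j)) -> D c ->
  exists2 a, D a & op (replace_at x i a) = c.

Definition comm_group_on D op : Prop :=
  [/\ forall x : {ffun 'I_n -> A}, (forall i, D (x i)) -> D (op x),
      total_assoc_on D op, perm_invariant_on D op & solvable_on D op].

End PolyadicOperations.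

Definition whole (A : Type) : A -> Prop := fun _ => True.

Definition distributive_over (A : Type) (m n : nat)
    (mu : {ffun 'I_n -> A} -> A) (nu : {ffun 'I_m -> A} -> A) : Prop :=
  forall (x : {ffun 'I_n -> A}) (i : 'I_n) (y : {ffun 'I_m -> A}),
  mu (replace_at x i (nu y)) = nu [ffun k => mu (replace_at x i (y k))].

Record polyadicRing (m n : nat) := PolyadicRing {
  polyadic_sort :> Type;
  nu : {ffun 'I_m -> polyadic_sort} -> polyadic_sort;
  mu : {ffun 'I_n -> polyadic_sort} -> polyadic_sort;
  nu_comm_group : comm_group_on (@whole polyadic_sort) nu;
  mu_total_assoc : total_assoc_on (@whole polyadic_sort) mu;
  mu_nu_distributive : distributive_over mu nu }.

Section PolyadicField.
Variables (m n : nat) (R : polyadicRing m n).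

Definition polyadic_zero (z : R) : Prop :=
  forall (x : {ffun 'I_n -> R}) (i : 'I_n), x i = z -> mu x = z.

(* A^*: all of A when there is no zero; for n >= 2 a zero is unique. *)
Definition polyadic_nonzero (a : R) : Prop :=
  forall z : R, polyadic_zero z -> a <> z.

Definition polyadic_field : Prop := comm_group_on polyadic_nonzero (@mu m n R).

End PolyadicField.

Definition polyadic_hom (m n : nat) (R S : polyadicRing m n) (f : R -> S) :
    Prop :=
  (forall x : {ffun 'I_m -> R}, f (nu x) = nu [ffun i => f (x i)]) /\
  (forall x : {ffun 'I_n -> R}, f (mu x) = mu [ffun i => f (x i)]).

(* The set {1 + b k | k in Z}, see class1P. *)
Definition class1 (b : nat) : Type := {x : int | (b%:Z %| x - 1)%Z}.

Lemma class1P (b : nat) (x : int) :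
  (b%:Z %| x - 1)%Z <-> exists k : int, x = 1 + b%:Z * k.
Proof.
split=> [/dvdzP[k xE] | [k ->]].
  by exists k; rewrite mulrC -xE addrC subrK.
by apply/dvdzP; exists k; rewrite addrC addKr mulrC.
Qed.

Lemma class1_sum_subproof (b : nat) (x : {ffun 'I_b.+1 -> class1 b}) :
  (b%:Z %| \sum_(i < b.+1) sval (x i) - 1)%Z.
Proof.
have -> : \sum_(i < b.+1) sval (x i) - 1 =
          \sum_(i < b.+1) (sval (x i) - 1) + b%:Z.
  rewrite sumrB sumr_const card_ord; set S := \sum_(i < _) _.
  have -> : (1 : int) *+ b.+1 = b%:Z + 1 by rewrite -natr1 natz.
  by move: S => S; lia.
by rewrite rpredD ?dvdzz // rpred_sum // => i _; apply: (svalP (x i)).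
Qed.

Lemma class1_mul_subproof (b : nat) (x y : class1 b) :
  (b%:Z %| sval x * sval y - 1)%Z.
Proof.
have -> : sval x * sval y - 1 = (sval x - 1) * sval y + (sval y - 1) by ring.
by rewrite rpredD ?dvdz_mulr //; [apply: (svalP x) | apply: (svalP y)].
Qed.

Definition class1_nu (b : nat) (x : {ffun 'I_b.+1 -> class1 b}) : class1 b :=
  exist _ (\sum_(i < b.+1) sval (x i)) (class1_sum_subproof x).

Definition class1_mu (b : nat) (x : {ffun 'I_2 -> class1 b}) : class1 b :=
  exist _ (sval (x ord0) * sval (x ord_max))
        (class1_mul_subproof (x ord0) (x ord_max)).

Lemma class1_nested_nu (b : nat) (w : nat -> class1 b) (k : 'I_b.+1) :
  sval (nested_op (@class1_nu b) w k) =
  \sum_(0 <= i < (b + b).+1) sval (w i).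
Proof.
have kb : (k <= b)%N by rewrite -ltnS.
pose F i := if (i < k)%N then sval (w i)
            else if i == k :> nat then \sum_(j < b.+1) sval (w (k + j)%N)
            else sval (w (i + b)%N).
rewrite /= (eq_bigr (fun i : 'I_b.+1 => F i)); last first.
  move=> i _; rewrite ffunE /F; case: ifP => // _.
  by rewrite -val_eqE; case: eqP => //= _; apply: eq_bigr => j _; rewrite ffunE.
rewrite -(big_mkord xpredT F) (big_cat_nat (n := k)) //=; last exact: ltnW.
rewrite [X in _ + X]big_ltn //.
rewrite [RHS](big_cat_nat (n := k)) //=; last by lia.
rewrite [X in _ = _ + X](big_cat_nat (n := (k + b).+1)) //=; [|lia|lia].
congr (_ + (_ + _)).
- by apply: eq_big_nat => i /andP[_ ik]; rewrite /F ik.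
- rewrite /F ltnn eqxx -{2}[k : nat]add0n big_addn.
  have -> : ((k + b).+1 - k = b.+1)%N by lia.
  by rewrite big_mkord; apply: eq_bigr => j _; rewrite addnC.
- have -> : ((k + b).+1 = k.+1 + b)%N by lia.
  rewrite big_addn; have -> : ((b + b).+1 - b = b.+1)%N by lia.
  apply: eq_big_nat => i /andP[ki _]; rewrite /F.
  by rewrite ltnNge (ltnW ki) /= gtn_eqF.
Qed.

Lemma class1_nu_comm_group (b : nat) :
  comm_group_on (@whole (class1 b)) (@class1_nu b).
Proof.
split=> [//|w _ k l|x _ s|x i c _ _].
- apply: val_inj.
  exact: etrans (class1_nested_nu w k) (esym (class1_nested_nu w l)).
- apply: val_inj => /=; rewrite [RHS](reindex_inj (@perm_inj _ s)).
  by apply: eq_bigr => i _; rewrite ffunE.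
- pose r := \sum_(j < b.+1 | j != i) sval (x j).
  have sumE a : \sum_(j < b.+1) sval (replace_at x i a j) = sval a + r.
    rewrite (bigD1 i) //= ffunE eqxx; congr (_ + _).
    by apply: eq_bigr => j ji; rewrite ffunE (negPf ji).
  have one_in : (b%:Z %| 1 - 1)%Z by rewrite subrr dvdz0.
  have a_in : (b%:Z %| (sval c - r) - 1)%Z.
    have := class1_sum_subproof (replace_at x i (exist _ 1 one_in)).
    rewrite sumE /= addrC addKr => br.
    by rewrite addrAC rpredB //; apply: (svalP c).
  exists (exist _ (sval c - r) a_in) => //.
  by apply: val_inj; rewrite /= sumE /= subrK.
Qed.

Lemma class1_mu_total_assoc (b : nat) :
  total_assoc_on (@whole (class1 b)) (@class1_mu b).
Proof.
have E (w : nat -> class1 b) (k : 'I_2) :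
    sval (nested_op (@class1_mu b) w k) =
    sval (w 0%N) * sval (w 1%N) * sval (w 2%N).
  case: k => -[|[|//]] k2; rewrite /= !ffunE -?val_eqE /= !ffunE //=.
  by rewrite mulrA.
by move=> w _ k l; apply: val_inj; exact: etrans (E w k) (esym (E w l)).
Qed.

Lemma class1_distributive (b : nat) :
  distributive_over (@class1_mu b) (@class1_nu b).
Proof.
move=> x i y; apply: val_inj => /=; rewrite !ffunE.
case: i => -[|[|//]] i2; rewrite -!val_eqE /= ?mulr_suml ?mulr_sumr;
  by apply: eq_bigr => k _; rewrite !ffunE /= !ffunE -!val_eqE.
Qed.

Definition class1_ring (b : nat) : polyadicRing b.+1 2 :=
  PolyadicRing (@class1_nu_comm_group b) (@class1_mu_total_assoc b)
               (@class1_distributive b).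

(* Main.v *)
Require Import Defs.
From mathcomp Require Import all_boot all_order all_fingroup all_algebra.
From HB Require Import structures.
From mathcomp Require Import ring zify.

Set Implicit Arguments.
Unset Strict Implicit.
Unset Printing Implicit Defensive.

Import GRing.Theory Num.Theory.
Local Open Scope ring_scope.

(** The integers of the class 1 + bZ are units modulo b, so they can be
    inverted inside the localization Z_(b) of Z at the integers coprime to b,
    and the inverses are again congruent to 1 modulo b.  The field is therefore
    the coset 1 + bZ_(b) of rationals, with the inclusion as embedding.

    Write J for the ideal bZ_(b).  A sum of b + 1 elements of 1 + J lies in
    b + 1 + J, which is 1 + J as b is in J; hence 1 + J is a (b+1)-ary
    additive group.  Products stay in 1 + J because J is stable under products,
    and inverses do because i / (1 + i) is in J for every i in J
    ([bideal_div1D]).  When b >= 2 the coset does not contain 0; a polyadic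
    zero z would satisfy z (1 + b) = z and be 0, so there is none, and the
    whole coset has to be, and is, a binary group under multiplication.

    Both operations iterate a commutative monoid law over the arguments, so
    the group axioms are obtained for both from [big_comm_group], whose only
    non-formal hypotheses are closure and divisibility. *)

(** * Polyadic groups from iterated commutative laws *)

(** The source of total associativity: the nested product reads the letters of
    w in order, so the place of the inner bracket does not matter. *)
Lemma big_nested (R : Type) (idx : R) (op : Monoid.law idx) (n : nat)
    (w : nat -> R) (k : 'I_n.+1) :
  \big[op/idx]_(i < n.+1)
    (if (i < k)%N then w i
     else if i == k then \big[op/idx]_(j < n.+1) w (k + j)%N
     else w (i + n)%N) =
  \big[op/idx]_(0 <= i < (n + n).+1) w i.
Proof.
have kn : (k <= n)%N by rewrite -ltnS.
pose F i := if (i < k)%N then w i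
            else if i == k :> nat then \big[op/idx]_(j < n.+1) w (k + j)%N
            else w (i + n)%N.
rewrite (eq_bigr (fun i : 'I_n.+1 => F i)) // -(big_mkord xpredT F).
(* The blocks before, at and after place k occupy the letters in [0, k),
   [k, k + n] and (k + n, 2n]. *)
rewrite (@big_cat_nat _ _ _ k) ?(ltnW (ltn_ord k)) //= [X in op _ X]big_ltn //.
rewrite [RHS](@big_cat_nat _ _ _ k) //=; last by lia.
rewrite [X in _ = op _ X](@big_cat_nat _ _ _ (k + n).+1) /=; [|lia|lia].
congr (op _ (op _ _)).
- by apply: eq_big_nat => i /andP[_ ik]; rewrite /F ik.
- rewrite /F ltnn eqxx -{2}[k : nat]add0n big_addn subSn ?leq_addr // addKn.
  by rewrite big_mkord; apply: eq_bigr => j _; rewrite addnC.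
- rewrite -addSn big_addn subSn ?leq_addl // addnK.
  by apply: eq_big_nat => i /andP[ki _]; rewrite /F ltnNge (ltnW ki) /= gtn_eqF.
Qed.

Section BigGroup.
Variables (R : Type) (idx : R) (op : Monoid.com_law idx) (P : pred R) (n : nat).
Let K := {r : R | P r}.

Hypothesis big_closed : forall x : {ffun 'I_n.+1 -> K},
  P (\big[op/idx]_(i < n.+1) sval (x i)).
Hypothesis big_solvable : forall (x : {ffun 'I_n.+1 -> K}) (i : 'I_n.+1) (c : K),
  exists a : K, op (sval a) (\big[op/idx]_(j < n.+1 | j != i) sval (x j)) = sval c.

Definition sub_big (x : {ffun 'I_n.+1 -> K}) : K :=
  exist _ (\big[op/idx]_(i < n.+1) sval (x i)) (big_closed x).

Lemma big_comm_group : comm_group_on (@whole K) sub_big.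
Proof.
have nestedE w k : sval (nested_op sub_big w k) =
    \big[op/idx]_(0 <= i < (n + n).+1) sval (w i).
  rewrite -(big_nested op _ k); apply: eq_bigr => i _; rewrite ffunE.
  case: ifP => // _; case: ifP => // _.
  by apply: eq_bigr => j _; rewrite ffunE.
split=> [//|w _ k l|x _ s|x i c _ _].
- by apply: val_inj; apply: etrans (nestedE w k) (esym (nestedE w l)).
- apply: val_inj => /=; rewrite [RHS](reindex_inj (@perm_inj _ s)).
  by apply: eq_bigr => i _; rewrite ffunE.
- have [a aE] := big_solvable x i c; exists a => //.
  apply: val_inj => /=; rewrite (bigD1 i) //= ffunE eqxx -aE; congr (op _ _).
  by apply: eq_bigr => j ji; rewrite ffunE (negPf ji).
Qed.

End BigGroup.

(** * The ideal bZ_(b) of the localization of the integers at b *)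

(** In lowest terms, b dividing the numerator already forces the denominator
    to be coprime to b, so no condition on it appears. *)
Definition bideal (b : nat) : {pred rat} := [pred r | (b%:Z %| numq r)%Z].

Lemma coprime_denq_bideal (b : nat) (r : rat) : r \in bideal b -> coprimez b (denq r).
Proof. by move=> br; apply: coprimez_dvdl br (coprime_num_den r). Qed.

(** Membership can be tested on any fraction p / q representing r, reduced or
    not, as long as q is coprime to b. *)
Lemma bideal_frac (b : nat) (r : rat) (p q : int) :
  q != 0 -> coprimez b q -> (b%:Z %| p)%Z -> r * q%:~R = p%:~R ->
  r \in bideal b.
Proof.
move=> q0 bq bp rE; rewrite inE -(Gauss_dvdzl _ bq).
suff -> : numq r * q = p * denq r by apply: dvdz_mulr.
apply: (intr_inj (R := rat)); rewrite !rmorphM /= -rE numqE; ring.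
Qed.

Lemma bideal_int (b : nat) (p : int) : (b%:Z %| p)%Z -> p%:~R \in bideal b.
Proof. by move=> bp; rewrite inE numq_int. Qed.

Fact bideal_zmod_closed b : zmod_closed (bideal b).
Proof.
split=> [|r s rb sb]; first by rewrite inE dvdz0.
apply: (@bideal_frac b _ (numq r * denq s - numq s * denq r) (denq r * denq s)).
- by rewrite mulf_neq0 ?denq_neq0.
- by rewrite coprimezMr !coprime_denq_bideal.
- by rewrite rpredB ?dvdz_mulr.
- rewrite rmorphB !rmorphM /= !numqE; ring.
Qed.
HB.instance Definition _ b :=
  GRing.isZmodClosed.Build rat (bideal b) (bideal_zmod_closed b).

Lemma bidealM b r s : r \in bideal b -> s \in bideal b -> r * s \in bideal b.
Proof.
move=> rb sb; apply: (@bideal_frac b _ (numq r * numq s) (denq r * denq s)).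
- by rewrite mulf_neq0 ?denq_neq0.
- by rewrite coprimezMr !coprime_denq_bideal.
- by rewrite dvdz_mulr.
- rewrite !rmorphM /= !numqE; ring.
Qed.

(** If r = p / q then r / (1 + r) = p / (p + q), where b divides p and
    p + q is coprime to b along with q. *)
Lemma bideal_div1D b r : 1 + r != 0 -> r \in bideal b -> r / (1 + r) \in bideal b.
Proof.
move=> r1 rb.
have pqE : (numq r + denq r)%:~R = (1 + r) * (denq r)%:~R.
  by rewrite rmorphD /= numqE mulrDl mul1r addrC.
apply: (@bideal_frac b _ (numq r) (numq r + denq r)) => //.
- by rewrite -(intr_eq0 rat) pqE mulf_neq0 // intr_eq0 denq_neq0.
- have /dvdzP[k ->] := rb.
  by rewrite /coprimez gcdzMDl; apply: coprime_denq_bideal.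
- by rewrite pqE mulrA divfK // numqE.
Qed.

(** * The coset 1 + bZ_(b) as a polyadic field *)

Definition bcoset (b : nat) : {pred rat} := [pred r | r - 1 \in bideal b].

Lemma bcosetE b r : (r \in bcoset b) = (r - 1 \in bideal b).
Proof. by []. Qed.

Lemma bcoset1 b : 1 \in bcoset b.
Proof. by rewrite bcosetE subrr rpred0. Qed.

Lemma bcosetM b r s : r \in bcoset b -> s \in bcoset b -> r * s \in bcoset b.
Proof.
rewrite !bcosetE => rb sb.
have -> : r * s - 1 = (r - 1) * (s - 1) + (r - 1) + (s - 1) by ring.
exact: rpredD (rpredD (bidealM rb sb) rb) sb.
Qed.

Lemma bcoset_neq0 b r : (2 <= b)%N -> r \in bcoset b -> r != 0.
Proof.
move=> b2; apply: contraTneq => ->.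
by rewrite bcosetE sub0r inE /= dvdzE /= dvdn1; case: b b2 => [|[]].
Qed.

Lemma bcosetV b r : (2 <= b)%N -> r \in bcoset b -> r^-1 \in bcoset b.
Proof.
move=> b2 rb; have r0 := bcoset_neq0 b2 rb.
have := @bideal_div1D b (r - 1); rewrite addrC subrK => /(_ r0 rb).
by rewrite mulrBl divff // mul1r bcosetE -opprB rpredN.
Qed.

(** Sums of elements of 1 + J are tracked modulo J by their number of terms;
    what matters below is that b + 1 terms count as 1 and b terms as 0. *)
Lemma bcoset_sum b (I : finType) (Q : pred I) (x : I -> {r | r \in bcoset b}) :
  \sum_(i | Q i) sval (x i) - #|Q|%:R \in bideal b.
Proof.
by rewrite -sumr_const -sumrB rpred_sum // => i _; apply: (svalP (x i)).
Qed.

Lemma bideal_nat (b : nat) : b%:R \in bideal b.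
Proof. by rewrite -[b%:R]/((b%:Z)%:~R) bideal_int. Qed.

Section Localization.
Variables (b : nat) (b_ge2 : (2 <= b)%N).
Let K := {r : rat | bcoset b r}.

Fact bcoset_sum_closed (x : {ffun 'I_b.+1 -> K}) :
  bcoset b (\sum_(i < b.+1) sval (x i)).
Proof.
rewrite -[bcoset b _]/(_ - 1 \in bideal b).
have := rpredD (bcoset_sum xpredT x) (bideal_nat b).
by rewrite card_ord -natr1 opprD addrA addrAC subrK.
Qed.

Fact bcoset_sum_solvable (x : {ffun 'I_b.+1 -> K}) (i : 'I_b.+1) (c : K) :
  exists a : K, sval a + \sum_(j < b.+1 | j != i) sval (x j) = sval c.
Proof.
set s := \sum_(j < _ | _) _.
have sb : s \in bideal b.
  have := rpredD (bcoset_sum (predC1 i) x) (bideal_nat b).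
  by rewrite cardC1 card_ord subrK.
have ab : bcoset b (sval c - s).
  rewrite -[bcoset b _]/(_ - 1 \in bideal b) addrAC.
  exact: rpredB (svalP c) sb.
by exists (exist _ (sval c - s) ab); rewrite /= subrK.
Qed.

(** The filter Q covers both the product itself and the product of the
    remaining argument, which is inverted to solve equations. *)
Fact bcoset_prod_closed (Q : pred 'I_2) (x : {ffun 'I_2 -> K}) :
  bcoset b (\prod_(i < 2 | Q i) sval (x i)).
Proof.
by apply: (big_ind (bcoset b)) => [|r s|i _];
  [exact: bcoset1 | exact: bcosetM | exact: (svalP (x i))].
Qed.

Fact bcoset_prod_solvable (x : {ffun 'I_2 -> K}) (i : 'I_2) (c : K) :
  exists a : K, sval a * \prod_(j < 2 | j != i) sval (x j) = sval c.
Proof.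
have sb := bcoset_prod_closed (predC1 i) x.
have ab := bcosetM (svalP c) (bcosetV b_ge2 sb).
by exists (exist (bcoset b) _ ab); rewrite /= divfK // (bcoset_neq0 b_ge2 sb).
Qed.

Let bnu := sub_big bcoset_sum_closed.
Let bmu := sub_big (bcoset_prod_closed xpredT).

Let bmu_group : comm_group_on (@whole K) bmu.
Proof. exact: big_comm_group bcoset_prod_solvable. Qed.

Fact bcoset_distributive : distributive_over bmu bnu.
Proof.
move=> x i y; apply: val_inj => /=.
rewrite (bigD1 i) //= ffunE eqxx mulr_suml; apply: eq_bigr => k _.
rewrite ffunE /= [RHS](bigD1 i) //= ffunE eqxx; congr (_ * _).
by apply: eq_bigr => j ji; rewrite !ffunE (negPf ji).
Qed.

Definition bcoset_ring : polyadicRing b.+1 2 :=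
  PolyadicRing (big_comm_group bcoset_sum_closed bcoset_sum_solvable)
    (let: And4 _ assoc _ _ := bmu_group in assoc) bcoset_distributive.

Lemma bcoset_no_zero (z : bcoset_ring) : ~ polyadic_zero z.
Proof.
have b1 : bcoset b (1 + b%:R).
  by rewrite -[bcoset b _]/(_ - 1 \in bideal b) addrC addKr bideal_nat.
(* Multiplying z by 1 + b gives z b = 0, although neither factor is 0. *)
pose x : {ffun 'I_2 -> K} :=
  [ffun i => if i == ord0 then z else exist (bcoset b) _ b1].
move=> /(_ x ord0); rewrite ffunE eqxx => /(_ erefl) /(congr1 sval).
rewrite /= big_ord_recl big_ord1 !ffunE /= mulrDr mulr1 => /eqP.
rewrite -subr_eq0 addrAC subrr add0r mulf_eq0 pnatr_eq0.
by rewrite (negPf (bcoset_neq0 b_ge2 (svalP z))) gtn_eqF // ltnW.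
Qed.

Lemma bcoset_field : polyadic_field bcoset_ring.
Proof.
have nz (a : bcoset_ring) : polyadic_nonzero a by move=> z /bcoset_no_zero.
have [_ assoc perm solv] := bmu_group; split=> //.
- by move=> w _; apply: assoc.
- by move=> x _; apply: perm.
- by move=> x i c _ _; have [//|//|a _ aE] := solv x i c; exists a.
Qed.

Fact class1_bcoset (x : class1 b) : bcoset b (sval x)%:~R.
Proof.
rewrite -[bcoset b _]/(_ - 1 \in bideal b) -[1]/(1%:~R) -rmorphB.
exact/bideal_int/(svalP x).
Qed.

Definition class1_embed (x : class1_ring b) : bcoset_ring :=
  exist (bcoset b) _ (class1_bcoset x).

Lemma class1_embed_inj : injective class1_embed.
Proof. by move=> x y /(congr1 sval) /intr_inj /val_inj. Qed.

Lemma class1_embed_hom : polyadic_hom class1_embed.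
Proof.
split=> x; apply: val_inj => /=.
  by rewrite rmorph_sum; apply: eq_bigr => i _; rewrite ffunE.
rewrite rmorphM big_ord_recl big_ord1 !ffunE /=.
by congr (_ * (sval (x _))%:~R); apply: val_inj.
Qed.

End Localization.

Theorem proposition6p20 (b : nat) (b_ge2 : (2 <= b)%N) :
  exists (K : polyadicRing b.+1 2) (f : class1_ring b -> K),
    [/\ polyadic_field K, injective f & polyadic_hom f].
Proof.
exists (bcoset_ring b_ge2), (@class1_embed b b_ge2); split.
- exact: bcoset_field.
- exact: class1_embed_inj.
- exact: class1_embed_hom.
Qed.
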